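(* Let $\mathbb{R}^m=\mathbb{R}^{m_1}\times\mathbb{R}^{m_2}$ with coordinates $z=(x,y)$, let $f:\mathbb{R}^m\to\mathbb{R}$ be a $C^1$ function on the whole of $\mathbb{R}^m$, fix $0<\alpha,\beta<1$ and $\delta_0>0$, and let $\{z_n\}_{n\ge 0}$ be a sequence constructed from Coordinate-wise Backtracking GD for $f$ (with parameters $\alpha,\beta,\delta_0$), starting from an initial point $z_0\in\mathbb{R}^m$. Then: 1) Every cluster point of $\{z_n\}$ is a critical point of $f$. 2) Either $\lim_{n\to\infty}f(z_n)=-\infty$ or $\lim_{n\to\infty}\|z_{n+1}-z_n\|=0$. 3) Let $B$ be a compact (connected) component of the set of critical points of $f$, and let $C$ be the set of cluster points of $\{z_n\}$. If $B\cap C\neq\emptyset$, then $C\subset B$ and $C$ is connected.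
   Context: Write $\nabla f=(\partial_x f,\partial_y f)$ with $\partial_x f(z)\in\mathbb{R}^{m_1}$ and $\partial_y f(z)\in\mathbb{R}^{m_2}$; $\|\cdot\|$ is the Euclidean norm, so $\|\nabla f(z)\|^2=\|\partial_x f(z)\|^2+\|\partial_y f(z)\|^2$. A critical point of $f$ is a point $z$ with $\nabla f(z)=0$. Cluster points are taken in $\mathbb{R}^m$ (limits of convergent subsequences). Coordinate-wise Backtracking GD. Let $0<\alpha,\beta<1$ and $\delta_0>0$, and let $D=\{\beta^n\delta_0: n=0,1,2,\ldots\}$. For each $z=(x,y)\in\mathbb{R}^m$ define numbers $\delta(z),\delta_x(z),\delta_y(z)\in D$ as follows. (Usual Armijo learning rate) $\delta(z)$ is the largest $\delta\in D$ such that $$f(z-\delta\nabla f(z))-f(z)\le-\alpha\,\delta\,\|\nabla f(z)\|^2.$$ (Step 1) $\delta_x(z)$ is the largest $\delta_1\in D$ with $\delta_1\ge\delta(z)$ such that $$f\big(x-\delta_1\partial_x f(z),\,y-\delta(z)\partial_y f(z)\big)-f(z)\le-\alpha\big(\delta_1\|\partial_x f(z)\|^2+\delta(z)\|\partial_y f(z)\|^2\big).$$ (Step 2) $\delta_y(z)$ is the largest $\delta_2\in D$ with $\delta_2\ge\delta(z)$ such that $$f\big(x-\delta_x(z)\partial_x f(z),\,y-\delta_2\partial_y f(z)\big)-f(z)\le-\alpha\big(\delta_x(z)\|\partial_x f(z)\|^2+\delta_2\|\partial_y f(z)\|^2\big).$$ Given an initial point $z_0\in\mathbb{R}^m$, the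 sequence constructed from Coordinate-wise Backtracking GD is defined inductively, with $z_n=(x_n,y_n)$, by $$z_{n+1}=\big(x_n-\delta_x(z_n)\,\partial_x f(z_n),\;y_n-\delta_y(z_n)\,\partial_y f(z_n)\big).$$ *)

(* Defs.v *)
From mathcomp Require Export all_boot all_order all_algebra.
From mathcomp Require Export all_classical all_reals all_analysis.
Export Order.TTheory GRing.Theory Num.Theory numFieldNormedType.Exports.

Set Implicit Arguments.
Unset Strict Implicit.
Unset Printing Implicit Defensive.

Local Open Scope classical_set_scope.
Local Open Scope ring_scope.

(* The library norm `|v| on row vectors is the sup norm; it induces the same
   topology. *)
Definition enorm (R : realType) (m : nat) (v : 'rV[R]_m) : R :=
  Num.sqrt (\sum_i v 0 i ^+ 2).

Definition gradient (R : realType) (m : nat) (f : 'rV[R]_m -> R)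
    (z : 'rV[R]_m) : 'rV[R]_m :=
  \row_i 'D_(delta_mx 0 i) f z.

Definition C1 (R : realType) (m : nat) (f : 'rV[R]_m -> R) : Prop :=
  (forall z, differentiable f z) /\ continuous (gradient f).

Definition critical_set (R : realType) (m : nat) (f : 'rV[R]_m -> R) :
  set 'rV[R]_m := [set z | gradient f z = 0].

Definition cluster_points (T : topologicalType) (z : nat -> T) : set T :=
  [set p | exists2 phi : nat -> nat,
     increasing_seq phi & z \o phi @ \oo --> p].

(* The default 0 is returned only when A has no largest element, which cannot
   happen in the definitions below when f is differentiable, 0 < alpha < 1,
   0 < beta < 1 and 0 < delta0. *)
Definition largest (R : realType) (A : set R) : R := xget 0 (A `&` ubound A).

Section CoordinateWiseBacktrackingGD.
Variables (R : realType) (m1 m2 : nat) (f : 'rV[R]_(m1 + m2) -> R).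
Variables (alpha beta delta0 : R).
Implicit Types z : 'rV[R]_(m1 + m2).

Definition gradx z : 'rV[R]_m1 := lsubmx (gradient f z).
Definition grady z : 'rV[R]_m2 := rsubmx (gradient f z).

Definition rates : set R := [set beta ^+ n * delta0 | n in [set: nat]].

Definition delta z : R :=
  largest [set d | rates d /\
    f (z - d *: gradient f z) - f z
      <= - alpha * d * enorm (gradient f z) ^+ 2].

Definition cw_step z (dx dy : R) : 'rV[R]_(m1 + m2) :=
  row_mx (lsubmx z - dx *: gradx z) (rsubmx z - dy *: grady z).

Definition cw_armijo z (dx dy : R) : Prop :=
  f (cw_step z dx dy) - f z
    <= - alpha * (dx * enorm (gradx z) ^+ 2 + dy * enorm (grady z) ^+ 2).

Definition delta_x z : R :=
  largest [set d | [/\ rates d, delta z <= d & cw_armijo z d (delta z)]].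

Definition delta_y z : R :=
  largest [set d | [/\ rates d, delta z <= d & cw_armijo z (delta_x z) d]].

Definition cwBGD_sequence (z0 : 'rV[R]_(m1 + m2))
    (z : nat -> 'rV[R]_(m1 + m2)) : Prop :=
  z 0%N = z0 /\
  forall n, z n.+1 = cw_step (z n) (delta_x (z n)) (delta_y (z n)).

End CoordinateWiseBacktrackingGD.

(* Main.v *)
Require Import Defs.
From mathcomp Require Import lra.

(* Step 2 of the algorithm inherits the Armijo estimate of Step 1, and both
   partial rates lie between delta z and delta0. Hence one step decreases f by
   at least alpha * delta z * |G z|^2, where G is the gradient, and by at least
   (alpha / delta0) * |step|^2. The second bound gives part 2. Around a
   noncritical p a fixed rate satisfies the Armijo inequality strictly at p,
   hence by continuity at all nearby points; so delta is bounded below there,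
   and a cluster point at p would contradict the convergence of f (z n).
   For part 3, a sequence with vanishing steps cannot have cluster points both
   in a compact set A and in a closed set A' disjoint from A without having one
   outside A and A', in a shell around A. Apply this first to a clopen part A of
   the critical set isolating the compact component B inside a ball (components
   of a compact set are intersections of relatively clopen sets), which bounds
   the cluster set; then to a hypothetical separation of the cluster set, which
   shows that it is connected and hence contained in B. *)

Set Implicit Arguments.
Unset Strict Implicit.
Unset Printing Implicit Defensive.

Local Open Scope classical_set_scope.
Local Open Scope ring_scope.

(** * Cluster points of sequences in normed spaces *)

Lemma cluster_pointsP (R : realType) (V : normedModType R) (u : nat -> V) p :
  cluster_points u p <->
  forall e : R, 0 < e -> forall N, exists2 n, (N <= n)%N & `|p - u n| <= e.
Proof.
(* The real sequence of distances to [p], clustering at 0, reduces the claim to dimension one. *)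
pose v n := `|p - u n| : R.
have vE : cluster_points u p <-> cluster (v @ \oo) 0.
  rewrite cluster_eventually_cvg; split=> -[phi phi_incr cvg_phi];
    exists phi => //.
    apply/cvgrPdist_lt => e e0; move/cvgrPdist_lt : cvg_phi => /(_ _ e0).
    by apply: filterS => n; rewrite /v/= sub0r normrN normr_id.
  apply/cvgrPdist_lt => e e0; move/cvgrPdist_lt : cvg_phi => /(_ _ e0).
  by apply: filterS => n; rewrite /v/= sub0r normrN normr_id.
rewrite vE cluster_eventuallyP; split=> H.
  move=> e e0 N; have [n Nn] := H e N e0.
  by rewrite [0 - _]sub0r normrN normr_id; exists n.
move=> e N e0; have [n Nn pn] := H e e0 N.
by exists n => //; rewrite sub0r normrN normr_id.
Qed.

Lemma cluster_points_cluster (R : realType) (V : normedModType R) (u : nat -> V) :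
  cluster_points u = cluster (u @ \oo).
Proof.
apply/seteqP; split=> p.
  move=> /cluster_pointsP up A B [N _ NA] /nbhs_ballP[e /= e0 eB].
  have e20 : 0 < e / 2 by rewrite divr_gt0.
  have [n Nn une] := up _ e20 N; exists (u n); split; first exact: NA.
  by apply: eB; rewrite -ball_normE /=; lra.
move=> up; apply/cluster_pointsP => e e0 N.
have [x [[n Nn <-] pe]] :
    ([set u n | n in [set n | (N <= n)%N]] `&` ball p e) !=set0.
  by apply: up; [exists N => // n Nn; exists n|exact: nbhsx_ballx].
by exists n => //; move: pe; rewrite -ball_normE => /ltW.
Qed.

Lemma closed_cluster_points (R : realType) (V : normedModType R) (u : nat -> V) :
  closed (cluster_points u).
Proof.
rewrite cluster_points_cluster clusterE.
by apply: closed_bigI => A _; exact: closed_closure.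
Qed.

(** The filter [F] follows [u] along the indices with [u n] in [S]. It is proper as there are
    infinitely many of them, and it is finer than [u @ \oo]. *)
Lemma compact_cluster_points (R : realType) (V : normedModType R)
    (u : nat -> V) (X S : set V) :
  compact X -> S `<=` X ->
  (forall N, exists2 n, (N <= n)%N & S (u n)) ->
  cluster_points u `&` closure S !=set0.
Proof.
move=> cX SX uS; pose F := u @ within [set n | S (u n)] \oo.
have FF : ProperFilter F.
  apply: Build_ProperFilter_ex => A [N _ NA].
  by have [n Nn Sn] := uS N; exists (u n); exact: NA.
have FS : F S by exists 0%N => // n _ Sn.
have [t [_ Ft]] := cX F FF (filterS SX FS).
exists t; split; last by move: Ft; rewrite clusterE; exact.
rewrite cluster_points_cluster; apply: (cvg_cluster _ Ft) => A [N _ NA].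
by exists N => // n Nn _; exact: NA.
Qed.

(** * Separation and quasi-components of compact sets *)

Lemma compact_closed_separation (R : realType) (V : normedModType R)
    (A A' : set V) : compact A -> closed A' -> A `&` A' = set0 ->
  exists2 r : R, 0 < r & forall a a', A a -> A' a' -> r <= `|a - a'|.
Proof.
move=> cA cA' AA'0.
(* Compactness as near-covering: it is enough that near each point of [A] all small [r] work. *)
have : \forall r \near 0^'+, A `<=` [set a | forall a', A' a' -> r <= `|a - a'|].
  move/compact_near_coveringP : cA; apply => a Aa.
  have nA'a : (~` A') a by move=> A'a; have : set0 a by rewrite -AA'0.
  have : nbhs a (~` A').
    by apply: open_nbhs_nbhs; split => //; exact: closed_openC.
  move=> /nbhs_ballP[e /= e0 eA'].
  exists (ball a (e / 2), [set r : R | r < e / 2]) => /=.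
    split; first by apply: nbhsx_ballx; rewrite divr_gt0.
    by apply: nbhs_right_lt; rewrite divr_gt0.
  move=> [x r] /= [ax re] a' A'a'; rewrite leNgt; apply/negP => xa'.
  apply: (eA' a') => //; move: ax; rewrite -!ball_normE /= => ax.
  have := ler_distD x a a'; lra.
move=> H; have [r []] := filter_ex (filterI H (nbhs_right_gt (0 : R))).
by move=> Ar r0; exists r => // a a' /Ar; exact.
Qed.

Lemma closed_separatedl (T : topologicalType) (A B : set T) :
  closed (A `|` B) -> separated A B -> closed A.
Proof.
move=> clAB [/disjoints_subset AB _] x Ax.
by have [//|Bx] := clAB x (closureS (@subsetUl _ A B) Ax); case: (AB x Ax).
Qed.

Section quasi_component.
Variables (R : realType) (V : normedModType R) (X : set V) (p : V).
Hypotheses (cX : compact X) (Xp : X p).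

Let clX : closed X.
Proof. by apply: compact_closed => //; exact: norm_hausdorff. Qed.

(** Since [X] is closed, closedness in [V] and in [X] agree for these sets. *)
Let rel_clopen (A : set V) := [/\ A p, A `<=` X, closed A & closed (X `\` A)].

Let rel_clopenI A A' : rel_clopen A -> rel_clopen A' -> rel_clopen (A `&` A').
Proof.
move=> [Ap AX clA clXA] [A'p A'X clA' clXA']; split => //.
- by move=> x [/AX].
- exact: closedI.
- by rewrite setDIr; exact: closedU.
Qed.

(** The quasi-component of [p] in [X]. *)
Let Q := \bigcap_(A in rel_clopen) A.

Let rel_clopen_X : rel_clopen X.
Proof. by split => //; rewrite setDv; exact: closed0. Qed.

(** Otherwise the sets [A] minus [U] form a filter base on the compact [X], and a cluster point of
    it lies in [Q] but outside [U]. *)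
Let rel_clopen_sub (U : set V) : open U -> Q `<=` U ->
  exists2 A, rel_clopen A & A `<=` U.
Proof.
move=> oU QU; apply: contrapT => noA.
pose F := filter_from rel_clopen (fun A => A `\` U).
have FF : ProperFilter F.
  apply: filter_from_proper.
    apply: filter_from_filter; first by exists X.
    move=> A A' hA hA'; exists (A `&` A'); first exact: rel_clopenI.
    by move=> x [[Ax A'x] nUx]; split; split.
  move=> A hA; apply/set0P/eqP => AU0; apply: noA; exists A => //.
  by rewrite -setD_eq0.
have FX : F X by exists X => // x [].
have [t [_ Ft]] := cX FF FX.
have clD A : rel_clopen A -> closed (A `\` U).
  by move=> [_ _ clA _]; apply: closedI => //; exact: open_closedC.
have tD A : rel_clopen A -> (A `\` U) t.
  move=> hA; apply: (clD _ hA); move: Ft; rewrite clusterE; apply.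
  by exists A.
have [_ nUt] := tD _ rel_clopen_X.
by apply/nUt/QU => A /tD [].
Qed.

(** Two separated pieces of [Q] are compact and have disjoint open thickenings. Some relatively
    clopen [A] lies in their union, and its part in the thickening around [p] is again relatively
    clopen, so it contains [Q] and leaves nothing for the other piece. *)
Let connectedQ : connected Q.
Proof.
apply/connectedP => E [E0 QE sE].
wlog Ep : E E0 QE sE / E false p.
  move=> G; have : Q p by move=> A [].
  rewrite QE => -[Ep|Ep]; first exact: (G E).
  by apply: (G (E \o negb)) => //;
    [case => /=|rewrite QE setUC|rewrite separatedC].
have clQ : closed Q by apply: closed_bigI => A [].
have EQ b : E b `<=` Q by rewrite QE; case: b => x; [right|left].
have clE b : closed (E b).
  rewrite QE in clQ; case: b; last exact: closed_separatedl clQ sE.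
  by rewrite separatedC in sE; rewrite setUC in clQ; exact: closed_separatedl sE.
have cE b : compact (E b).
  apply: (subclosed_compact (clE b) cX) => x /EQ; apply; exact: rel_clopen_X.
have [r r0 rE] := compact_closed_separation (cE false) (clE true)
  (separated_disjoint sE).
pose U b := \bigcup_(a in E b) ball a (r / 2).
have oU b : open (U b) by apply: bigcup_open => a _; exact: ball_open.
have EU b : E b `<=` U b.
  by move=> x Ex; exists x => //; apply: ballxx; rewrite divr_gt0.
have UU x : U false x -> U true x -> False.
  move=> [a Ea ax] [a' Ea' ax']; move: ax ax'; rewrite -!ball_normE /= => ax ax'.
  by have := rE _ _ Ea Ea'; have := ler_distD x a a'; rewrite (distrC x a'); lra.
have [A [Ap AX clA clXA] AU] :
    exists2 A, rel_clopen A & A `<=` U false `|` U true.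
  apply: rel_clopen_sub; first exact: openU.
  by rewrite QE; exact: setUSS.
have hA1 : rel_clopen (A `&` U false).
  split.
  - by split => //; exact: EU.
  - by move=> x [/AX].
  (* Within [A], lying in [U false] means avoiding the open set [U true], a closed condition. *)
  - rewrite (_ : _ `&` _ = A `&` ~` U true).
      by apply: closedI => //; exact: open_closedC.
    apply/seteqP; split=> x [Ax Ux]; split => //; first by move=> /(UU _ Ux).
    by have [] := AU x Ax.
  - rewrite setDIr; apply: closedU => //.
    by apply: closedI => //; exact: open_closedC.
have [q Eq] := E0 true.
have [_ /UU] : (A `&` U false) q by apply: (EQ _ _ Eq).
by apply; exact: EU.
Qed.

Lemma connected_component_clopen (U : set V) : open U ->
  connected_component X p `<=` U ->
  exists A, [/\ A p, A `<=` X `&` U, closed A & closed (X `\` A)].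
Proof.
move=> oU XpU; have [|A [Ap AX clA clXA] AU] := rel_clopen_sub oU.
  apply: subset_trans XpU; apply: connected_component_max => //.
    by move=> A [].
  by move=> x; apply; exact: rel_clopen_X.
by exists A; split => //; rewrite subsetI.
Qed.

End quasi_component.

(** * Bounded sets of row vectors *)

Lemma compact_closed_ball0 (R : realType) m (M : R) :
  0 < M -> compact [set x : 'rV[R]_m | `|x| <= M].
Proof.
move=> M0; apply: bounded_closed_compact.
  exists M; split; first exact: num_real.
  by move=> N /ltW MN x /= xM; exact: le_trans MN.
have -> : [set x : 'rV[R]_m | `|x| <= M] = closed_ball 0 M.
  by rewrite closed_ballE //; apply/seteqP; split => x;
    rewrite /closed_ball_ /= sub0r normrN.
exact: closed_ball_closed.
Qed.

Lemma compact_norm_le (R : realType) m (A : set 'rV[R]_m) : compact A ->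
  exists2 M : R, 0 < M & forall x, A x -> `|x| <= M.
Proof.
move=> /compact_bounded[M [_ MA]]; exists (`|M| + 1); first by rewrite ltr_wpDl.
by move=> x Ax; apply: (MA (`|M| + 1)) => //; have := ler_norm M; lra.
Qed.

(** * Cluster sets of sequences with vanishing steps *)

Section cluster_points_small_steps.
Variables (R : realType) (m : nat) (u : nat -> 'rV[R]_m).
Hypothesis u_step : `|u n.+1 - u n| @[n --> \oo] --> 0.

Lemma cluster_points_nosplit (A A' : set 'rV[R]_m) :
  compact A -> closed A' -> A `&` A' = set0 ->
  cluster_points u `<=` A `|` A' -> A `&` cluster_points u !=set0 ->
  cluster_points u `<=` A.
Proof.
move=> cA clA' AA'0 CAA' [p [Ap Cp]] q Cq; case: (CAA' _ Cq) => // A'q; exfalso.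
have [r r0 rAA'] := compact_closed_separation cA clA' AA'0.
have [M M0 AM] := compact_norm_le cA.
have r40 : 0 < r / 4 by rewrite divr_gt0.
pose W := \bigcup_(a in A) ball a (r / 2).
have Wr x : ~ W x -> forall a, A a -> r / 2 <= `|a - x|.
  move=> nWx a Aa; rewrite leNgt; apply/negP => ax; apply: nWx; exists a => //.
  by rewrite -ball_normE.
(* The shell: a step shorter than [r / 4] that leaves the [r / 2]-thickening [W] of [A] must land
   here. *)
pose S := [set x | ~ W x /\ exists2 a, A a & `|a - x| <= 3 / 4 * r].
have [N0 _ stepN0] : \forall n \near \oo, `|u n.+1 - u n| < r / 4.
  move/cvgrPdist_lt : u_step => /(_ _ r40); apply: filterS => n.
  by rewrite sub0r normrN normr_id.
have uS N : exists2 n, (N <= n)%N & S (u n).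
  move/cluster_pointsP : Cp => /(_ _ r40 (maxn N N0))[n].
  rewrite geq_max => /andP[Nn N0n] pun.
  have Wn : W (u n) by exists p => //; rewrite -ball_normE /=; lra.
  have [k nk quk] := (cluster_pointsP _ _).1 Cq _ r40 n.
  have nWk : ~ W (u k).
    move=> [a Aa]; rewrite -ball_normE /= => auk.
    have := rAA' _ _ Aa A'q; have := ler_distD (u k) a q.
    by rewrite (distrC (u k)); lra.
  (* An exit from [W] between the visits near [p] and near [q]; without one, induction would keep
     [u k] in [W]. *)
  have [j [nj Wj nWj]] : exists j, [/\ (n <= j)%N, W (u j) & ~ W (u j.+1)].
    apply: contrapT => noj; apply: nWk; rewrite -(subnKC nk).
    elim: (k - n)%N => [|j IHj]; first by rewrite addn0.
    rewrite addnS; apply: contrapT => nWj; apply: noj; exists (n + j)%N.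
    by split => //; exact: leq_addr.
  exists j.+1; first exact: leq_trans Nn (leqW nj).
  split => //; case: Wj => a Aa; rewrite -ball_normE /= => auj; exists a => //.
  have := stepN0 _ (leq_trans N0n nj); have := ler_distD (u j) a (u j.+1).
  rewrite (distrC (u j)); lra.
have Mr0 : 0 < M + r by rewrite addr_gt0.
have SM : S `<=` [set x | `|x| <= M + r].
  move=> x [_ [a /AM aM ax]] /=; have := ler_distD a x 0.
  rewrite !subr0 distrC; lra.
have [t [Ct St]] :=
  compact_cluster_points (compact_closed_ball0 (m := m) Mr0) SM uS.
(* A shell point [y] within [r / 4] of [t]: then [t] in [A] would put [y] in [W], and [t] in [A']
   would be closer than [r] to [a]. *)
have [y [[nWy [a Aa ay]]]] := St _ (nbhsx_ballx t _ r40).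
rewrite -ball_normE /= => ty.
have [At|A't] := CAA' _ Ct.
  by have := Wr _ nWy _ At; lra.
have := rAA' _ _ Aa A't; have := ler_distD y a t; rewrite (distrC y); lra.
Qed.

Lemma cluster_points_compact_component (K : set 'rV[R]_m) q : closed K ->
  cluster_points u `<=` K -> compact (connected_component K q) ->
  cluster_points u q ->
  cluster_points u `<=` connected_component K q /\ connected (cluster_points u).
Proof.
move=> clK CK cB Cq; have Kq := CK _ Cq.
have [M M0 BM] := compact_norm_le cB.
have M10 : 0 < M + 1 by rewrite addr_gt0.
(* [K] may be unbounded, so it is cut to a ball whose interior [U] contains the component, which has
   norm at most [M]. *)
pose D := [set x : 'rV[R]_m | `|x| <= M + 1].
have cD : compact D by exact: compact_closed_ball0.
pose X := K `&` D.
have cX : compact X by rewrite /X setIC; apply: compact_closedI.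
pose U := ball (0 : 'rV[R]_m) (M + 1).
have UE : U = [set x | `|x| < M + 1].
  by rewrite /U -ball_normE; apply/seteqP; split=> x /=; rewrite sub0r normrN.
have oU : open U by exact: ball_open.
have Bq : connected_component K q q by exact: connected_component_refl.
have Xq : X q by split => //; rewrite /D /=; have := BM _ Bq; lra.
have [|A [Aq AXU clA clXA]] := connected_component_clopen cX Xq oU.
  move=> x [G [Gq GX cG] Gx]; rewrite UE /=.
  have := BM x; suff Bx : connected_component K q x by move=> /(_ Bx); lra.
  by exists G => //; split => // y /GX[].
have cA : compact A by apply: (subclosed_compact clA cX) => x /AXU[].
have clA' : closed (K `\` A).
  (* Inside [U] the sets [K] and [X] agree; outside [U] there is no point of [A]. *)
  rewrite (_ : K `\` A = (X `\` A) `|` (K `\` U)).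
    by apply: closedU => //; apply: closedI => //; exact: open_closedC.
  apply/seteqP; split=> x.
    move=> [Kx nAx]; have [Ux|nUx] := pselect (U x); [left|by right].
    by split => //; split => //; move: Ux; rewrite UE => /ltW.
  by move=> [[[]]//|[Kx nUx]]; split => // /AXU[].
have CA : cluster_points u `<=` A.
  apply: (cluster_points_nosplit cA clA').
  - by apply/seteqP; split => x // [Ax []].
  - by move=> x /CK Kx; have [|] := pselect (A x); [left|right].
  - by exists q.
have cC : connected (cluster_points u).
  apply/connectedP => E [E0 CE sE].
  have EC b : E b `<=` cluster_points u by rewrite CE; case: b => x; [right|left].
  have clE b : closed (E b).
    have := closed_cluster_points (u := u); rewrite CE.
    case: b; last by move=> clC; exact: closed_separatedl clC sE.
    by rewrite setUC separatedC in sE * => clC; exact: closed_separatedl clC sE.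
  have cE : compact (E false).
    by apply: (subclosed_compact (clE false) cA) => x /EC/CA.
  have EE := separated_disjoint sE.
  have [x Ex] := E0 true; have [y Ey] := E0 false.
  (* The no-splitting lemma again, now applied to the two pieces of a supposed separation. *)
  have : cluster_points u `<=` E false.
    apply: (cluster_points_nosplit cE (clE true) EE); first by rewrite CE.
    by exists y; split => //; exact: EC Ey.
  move=> /(_ _ (EC _ _ Ex)) Ex'.
  by have : set0 x by rewrite -EE.
by split => //; exact: connected_component_max.
Qed.

End cluster_points_small_steps.

(** * Euclidean norm and gradient *)

Section euclidean_norm.
Variable R : realType.

Lemma enorm_ge0 m (v : 'rV[R]_m) : 0 <= enorm v.
Proof. exact: sqrtr_ge0. Qed.

Lemma sqr_enorm m (v : 'rV[R]_m) : enorm v ^+ 2 = \sum_i v 0 i ^+ 2.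
Proof. by rewrite sqr_sqrtr // sumr_ge0 // => i _; exact: sqr_ge0. Qed.

Lemma sqr_enorm_eq0 m (v : 'rV[R]_m) : (enorm v ^+ 2 == 0) = (v == 0).
Proof.
rewrite sqr_enorm psumr_eq0 => [|i _]; last exact: sqr_ge0.
apply/allP/eqP => [v0|-> i _]; last by rewrite mxE expr0n /= eqxx.
apply/rowP => i; rewrite mxE; apply/eqP; rewrite -sqrf_eq0.
by apply: (implyP (v0 i _)); rewrite ?mem_index_enum.
Qed.

Lemma sqr_enorm_row_mx m1 m2 (v : 'rV[R]_m1) (w : 'rV[R]_m2) :
  enorm (row_mx v w) ^+ 2 = enorm v ^+ 2 + enorm w ^+ 2.
Proof.
rewrite !sqr_enorm big_split_ord /=.
by congr (_ + _); apply: eq_bigr => i _; rewrite ?row_mxEl ?row_mxEr.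
Qed.

Lemma sqr_enormZ m (a : R) (v : 'rV[R]_m) :
  enorm (a *: v) ^+ 2 = a ^+ 2 * enorm v ^+ 2.
Proof.
by rewrite !sqr_enorm mulr_sumr; apply: eq_bigr => i _; rewrite mxE exprMn.
Qed.

(** Carries vanishing of Euclidean step lengths over to the sup norm of the topological lemmas. *)
Lemma norm_le_enorm m (v : 'rV[R]_m) : `|v| <= enorm v.
Proof.
rewrite [leLHS]/Num.norm /= mx_normrE; apply: bigmax_le => [|[i j] _ /=].
  exact: enorm_ge0.
rewrite (ord1 i) -ler_sqr ?nnegrE ?enorm_ge0 // sqr_enorm.
rewrite real_normK ?num_real // (bigD1 j) //= lerDl sumr_ge0 // => k _.
exact: sqr_ge0.
Qed.

Lemma continuous_sqr_enorm (T : topologicalType) m (g : T -> 'rV[R]_m) :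
  continuous g -> continuous (fun x => enorm (g x) ^+ 2).
Proof.
move=> cg; under eq_fun do rewrite sqr_enorm.
move=> x; apply: cvg_big => [|i _]; first exact: add_continuous.
have gi : g y 0 i @[y --> x] --> g x 0 i.
  exact: (continuous_comp (cg x) (@coord_continuous _ _ _ 0 i _)).
rewrite expr2; under eq_fun do rewrite expr2; exact: cvgM.
Qed.

End euclidean_norm.

Lemma derive_gradient (R : realType) m (f : 'rV[R]_m -> R) z v :
  differentiable f z -> 'D_v f z = \sum_i v 0 i * gradient f z 0 i.
Proof.
move=> df; rewrite deriveE // [in LHS](row_sum_delta v) linear_sum /=.
apply: eq_bigr => i _; rewrite linearZ /= -deriveE //.
by rewrite mxE.
Qed.

(** * The grid of learning rates *)

Section rates.
Variables (R : realType) (beta delta0 : R).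
Hypotheses (beta01 : 0 < beta < 1) (delta0_gt0 : 0 < delta0).

Lemma rates_itv d : rates beta delta0 d -> 0 < d <= delta0.
Proof.
case/andP: beta01 => b0 b1 [n _ <-]; rewrite mulr_gt0 ?exprn_gt0 //=.
by rewrite ger_pMl // exprn_ile1 // ltW.
Qed.

(** Rates decrease with the exponent, so the least exponent occurring in [A] gives its maximum; the
    default of [largest] is thus never returned. *)
Lemma largestP (A : set R) : A `<=` rates beta delta0 -> A !=set0 ->
  A (largest A) /\ ubound A (largest A).
Proof.
case/andP: beta01 => b0 b1 Arates [d Ad].
suff : exists x, (A `&` ubound A) x by exact: xgetPex.
have exA : exists n, `[< A (beta ^+ n * delta0) >].
  by have [n _ nd] := Arates _ Ad; exists n; apply/asboolP; rewrite nd.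
case: (ex_minnP exA) => n /asboolP An minn.
exists (beta ^+ n * delta0); split => // x Ax.
have [k _ kx] := Arates _ Ax; rewrite -kx.
rewrite ler_pM2r //; apply: ler_wiXn2l; try exact: ltW.
by apply: minn; apply/asboolP; rewrite kx.
Qed.

Lemma cvg_rates : (beta ^+ n * delta0) @[n --> \oo] --> 0.
Proof.
case/andP: beta01 => b0 b1; under eq_fun do rewrite mulrC.
by apply: cvg_geometric; rewrite ger0_norm // ltW.
Qed.

End rates.

(** * Armijo conditions and descent estimates *)

Section armijo.
Variables (R : realType) (m1 m2 : nat) (f : 'rV[R]_(m1 + m2) -> R).
Variables (alpha beta delta0 : R).
Hypotheses (C1f : C1 f) (alpha01 : 0 < alpha < 1) (beta01 : 0 < beta < 1).
Hypothesis delta0_gt0 : 0 < delta0.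
Implicit Types z p : 'rV[R]_(m1 + m2).

Local Notation G := (gradient f).
Local Notation armijo z d :=
  (f (z - d *: G z) - f z <= - alpha * d * enorm (G z) ^+ 2).
Local Notation rates := (rates beta delta0).
Local Notation delta := (delta f alpha beta delta0).
Local Notation delta_x := (delta_x f alpha beta delta0).
Local Notation delta_y := (delta_y f alpha beta delta0).

(** The slope of [f] along the negative gradient is minus the squared gradient norm, strictly below
    the Armijo slope as [alpha < 1]; rates tend to 0, so one of them is small enough. *)
Lemma strict_armijo_rate p : G p != 0 ->
  exists2 d, rates d &
    f (p - d *: G p) - f p < - alpha * d * enorm (G p) ^+ 2.
Proof.
move=> Gp0; case/andP: alpha01 => a0 a1; have [df _] := C1f.
have g0 : 0 < enorm (G p) ^+ 2.
  by rewrite lt_def sqr_enorm_eq0 Gp0 sqr_ge0.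
have DE : 'D_(- G p) f p = - enorm (G p) ^+ 2.
  rewrite derive_gradient // sqr_enorm -sumrN; apply: eq_bigr => i _.
  by rewrite !mxE mulNr expr2.
have dfp : h^-1 *: (f (h *: (- G p) + p) - f p) @[h --> 0^'] --> 'D_(- G p) f p.
  exact: (@diff_derivable _ _ _ f p (- G p) (df p)).
have lt_slope : 'D_(- G p) f p < - alpha * enorm (G p) ^+ 2.
  by rewrite DE mulNr ltrN2 gtr_pMl.
have [e /= e0 eP] := cvgr_lt _ dfp _ lt_slope.
have /cvgrPdist_lt/(_ _ e0)[N _ HN] := cvg_rates delta0 beta01.
pose d := beta ^+ N * delta0; have rd : rates d by exists N.
have /andP[d0 _] := rates_itv beta01 delta0_gt0 rd.
exists d => //; have := eP d (HN N (leqnn _)) (lt0r_neq0 d0).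
rewrite /= scalerN [- _ + p]addrC [_ *: (_ - _)]mulrC ltr_pdivrMr //.
by rewrite mulrAC.
Qed.

Lemma delta_spec z : [/\ rates (delta z), armijo z (delta z) &
  forall d, rates d -> armijo z d -> d <= delta z].
Proof.
have [||[rd Ad] ubd] := @largestP _ beta delta0 beta01 delta0_gt0
    [set d | rates d /\ armijo z d].
- by move=> d [].
- have [Gz0|/strict_armijo_rate[d rd /ltW Ad]] := eqVneq (G z) 0.
    (* At a critical point both sides of the inequality vanish, so [delta0] itself qualifies. *)
    exists (beta ^+ 0 * delta0); split; first by exists 0%N.
    rewrite Gz0 scaler0 subr0 subrr.
    have /eqP -> : enorm (0 : 'rV[R]_(m1 + m2)) ^+ 2 == 0.
      by rewrite sqr_enorm_eq0.
    by rewrite mulr0.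
  by exists d.
- by split => // d rd' Ad'; apply: ubd.
Qed.

Lemma cw_step_diag z d : cw_step f z d d = z - d *: G z.
Proof. by rewrite /cw_step /gradx /grady -!linearZ -!linearB hsubmxK. Qed.

Lemma sqr_enorm_gradient z :
  enorm (G z) ^+ 2 = enorm (gradx f z) ^+ 2 + enorm (grady f z) ^+ 2.
Proof. by rewrite -sqr_enorm_row_mx hsubmxK. Qed.

Lemma delta_x_spec z : [/\ rates (delta_x z), delta z <= delta_x z &
  cw_armijo f alpha z (delta_x z) (delta z)].
Proof.
have [rd Ad _] := delta_spec z.
have [||H _] := @largestP _ beta delta0 beta01 delta0_gt0
  [set d | [/\ rates d, delta z <= d & cw_armijo f alpha z d (delta z)]].
- by move=> d [].
(* With equal rates the coordinate-wise condition is the usual Armijo condition. *)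
- exists (delta z); split => //.
  by rewrite /cw_armijo cw_step_diag -mulrDr -sqr_enorm_gradient mulrA.
- exact: H.
Qed.

Lemma delta_y_spec z : [/\ rates (delta_y z), delta z <= delta_y z &
  cw_armijo f alpha z (delta_x z) (delta_y z)].
Proof.
have [rd _ _] := delta_spec z; have [_ _ Ax] := delta_x_spec z.
have [||H _] := @largestP _ beta delta0 beta01 delta0_gt0
  [set d | [/\ rates d, delta z <= d & cw_armijo f alpha z (delta_x z) d]].
- by move=> d [].
(* For the second rate [delta z], the condition is exactly the one secured by [delta_x z]. *)
- by exists (delta z).
- exact: H.
Qed.

Local Notation next z := (cw_step f z (delta_x z) (delta_y z)).

Lemma cw_descent z :
  alpha * (delta z * enorm (G z) ^+ 2) <= f z - f (next z).
Proof.
case/andP: alpha01 => a0 _.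
have [_ dx _] := delta_x_spec z; have [_ dy] := delta_y_spec z.
rewrite /cw_armijo mulNr -opprB lerN2; apply: le_trans.
rewrite ler_pM2l // sqr_enorm_gradient mulrDr.
by rewrite lerD // ler_wpM2r // sqr_ge0.
Qed.

(** A rate [d] satisfies [d ^+ 2 <= delta0 * d], which turns the Armijo bound, linear in the rates,
    into one on the squared step. *)
Lemma sqr_enorm_cw_step z :
  alpha * enorm (next z - z) ^+ 2 <= delta0 * (f z - f (next z)).
Proof.
case/andP: alpha01 => a0 _.
have [/(rates_itv beta01 delta0_gt0)/andP[dx0 dx] _ _] := delta_x_spec z.
have [/(rates_itv beta01 delta0_gt0)/andP[dy0 dy] _] := delta_y_spec z.
rewrite /cw_armijo mulNr -opprB lerN2 => A.
have -> : next z - z =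
    row_mx (- (delta_x z *: gradx f z)) (- (delta_y z *: grady f z)).
  rewrite -[X in _ - X = _]hsubmxK /cw_step opp_row_mx add_row_mx.
  by rewrite ![_ - _ *: _]addrC !addrK.
rewrite sqr_enorm_row_mx -!scaleNr !sqr_enormZ !sqrrN.
apply: le_trans (ler_wpM2l (ltW delta0_gt0) A).
rewrite [leRHS]mulrCA ler_pM2l // mulrDr.
by apply: lerD; rewrite [leRHS]mulrA ler_wpM2r ?sqr_ge0 // expr2 ler_wpM2r // ltW.
Qed.

Lemma near_delta_ge p : G p != 0 ->
  exists2 d, 0 < d & \forall q \near p, d <= delta q.
Proof.
move=> /strict_armijo_rate[d rd Ad]; have [df cG] := C1f.
have /andP[d0 _] := rates_itv beta01 delta0_gt0 rd.
exists d => //.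
have cf : continuous f by move=> q; exact: differentiable_continuous.
(* [h q < 0] says that the fixed rate [d] satisfies the Armijo inequality strictly at [q]; then
   [d <= delta q] by maximality. *)
pose h (q : 'rV[R]_(m1 + m2)) :=
  f (q - d *: G q) - f q + alpha * d * enorm (G q) ^+ 2.
have cg2 := continuous_sqr_enorm cG.
have cs : continuous (fun q : 'rV[R]_(m1 + m2) => q - d *: G q).
  move=> q; apply: (cvgB (F := nbhs q)); first exact: cvg_id.
  by apply: (cvgZ (F := nbhs q)); [exact: cvg_cst|exact: cG].
have ch : continuous h.
  move=> q; apply: (cvgD (F := nbhs q)).
    apply: (cvgB (F := nbhs q)); last exact: cf.
    exact: (continuous_comp (cs q) (cf _)).
  by apply: (cvgM (F := nbhs q)); [exact: cvg_cst|exact: cg2].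
have hp : h p < 0 by move: Ad; rewrite /h !mulNr; lra.
have hlt : \forall q \near p, h q < 0 by exact: (cvgr_lt _ (ch p) _ hp).
apply: filterS hlt => q hq.
have [_ _] := delta_spec q; apply => //.
by move: hq; rewrite /h !mulNr; lra.
Qed.

(** * Behaviour of the iterates *)

Section sequence.
Variables (z0 : 'rV[R]_(m1 + m2)) (z : nat -> 'rV[R]_(m1 + m2)).
Hypothesis zE : cwBGD_sequence f alpha beta delta0 z0 z.

Lemma cwBGD_nonincreasing : {homo f \o z : i j / (i <= j)%N >-> (j <= i)%R}.
Proof.
apply/nonincreasing_seqP => n /=; rewrite -subr_ge0 zE.2.
apply: le_trans (cw_descent _); case/andP: alpha01 => a0 _.
have [/(rates_itv beta01 delta0_gt0)/andP[d0 _] _ _] := delta_spec (z n).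
by do 2 (apply: mulr_ge0; first exact: ltW); exact: sqr_ge0.
Qed.

Lemma cwBGD_decrease_cvg0 (M : R) : (forall n, M <= f (z n)) ->
  f (z n) - f (z n.+1) @[n --> \oo] --> 0.
Proof.
move=> Mf; have cv : cvgn (f \o z).
  apply: nonincreasing_is_cvgn; first exact: cwBGD_nonincreasing.
  by exists M => _ [n _ <-]; exact: Mf.
rewrite -(subrr (limn (f \o z))); apply: cvgB => //.
by rewrite (cvg_shiftS (f \o z)).
Qed.

Lemma cwBGD_unbounded_or_lbounded :
  f \o z @ \oo --> -oo \/ exists M, forall n, M <= f (z n).
Proof.
have [|nM] := pselect (exists M, forall n, M <= f (z n)); first by right.
left; apply/cvgrNyPlt => M.
have [n fn] : exists n, f (z n) < M.
  apply: contrapT => Mf; apply: nM; exists M => n; rewrite leNgt.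
  by apply/negP => fn; apply: Mf; exists n.
by exists n => // k /= nk; apply: le_lt_trans fn; exact: cwBGD_nonincreasing.
Qed.

Lemma cwBGD_step_cvg0 (M : R) : (forall n, M <= f (z n)) ->
  enorm (z n.+1 - z n) @[n --> \oo] --> 0.
Proof.
move=> /cwBGD_decrease_cvg0/cvgrPdist_lt f0; case/andP: alpha01 => a0 _.
apply/cvgrPdist_lt => e e0.
(* A decrease of [f] below this threshold forces a step shorter than [e]. *)
have e'0 : 0 < alpha * e ^+ 2 / delta0.
  by rewrite divr_gt0 // mulr_gt0 // exprn_gt0.
apply: filterS (f0 _ e'0) => n.
rewrite !sub0r !normrN ltr_pdivlMr // => fn.
rewrite ger0_norm ?enorm_ge0 // -ltr_sqr ?nnegrE ?enorm_ge0 ?ltW //.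
rewrite -(ltr_pM2l a0) zE.2; apply: le_lt_trans (sqr_enorm_cw_step _) _.
rewrite -zE.2 mulrC; apply: le_lt_trans fn.
by rewrite ler_pM2r // ler_norm.
Qed.

(** If [f (z n) < f p], then [f] exceeds [f (z n)] near [p], where the sequence returns after [n],
    against monotonicity. *)
Lemma cwBGD_lbounded p : cluster_points z p -> forall n, f p <= f (z n).
Proof.
rewrite cluster_points_cluster => Cp n; have [df _] := C1f.
rewrite leNgt; apply/negP => fnp.
have gtfn : \forall q \near p, f (z n) < f q.
  exact: (cvgr_gt _ (differentiable_continuous (df p)) _ fnp).
have [x [[k /= nk <-]]] : ([set z k | k in [set k | (n <= k)%N]] `&`
    [set q | f (z n) < f q]) !=set0.
  by apply: Cp => //; exists n => // k nk; exists k.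
by apply/negP; rewrite -leNgt; exact: cwBGD_nonincreasing.
Qed.

Lemma cluster_points_critical : cluster_points z `<=` critical_set f.
Proof.
move=> p Cp; apply: contrapT => /eqP Gp0; have [df cG] := C1f.
have [d d0 near_d] := near_delta_ge Gp0; case/andP: alpha01 => a0 _.
pose g (q : 'rV[R]_(m1 + m2)) := enorm (G q) ^+ 2.
have cg : continuous g by exact: continuous_sqr_enorm.
have g0 : 0 < g p by rewrite lt_def sqr_enorm_eq0 Gp0 sqr_ge0.
have near_g : \forall q \near p, g p / 2 < g q.
  have g2 : g p / 2 < g p by rewrite gtr_pMr // invf_lt1 // ltr1n.
  exact: (cvgr_gt _ (cg p) _ g2).
(* Every iterate close enough to [p] makes [f] drop by at least this amount. *)
have e0 : 0 < alpha * (d * (g p / 2)) 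
  by do 2 (apply: mulr_gt0; first by []); exact: divr_gt0.
have /cvgrPdist_lt/(_ _ e0)[N _ decN] := cwBGD_decrease_cvg0 (cwBGD_lbounded Cp).
rewrite cluster_points_cluster in Cp.
have [x [[k /= Nk <-] [dk gk]]] : ([set z k | k in [set k | (N <= k)%N]] `&`
    [set q | d <= delta q /\ g p / 2 < g q]) !=set0.
  apply: Cp; first by exists N => // k Nk; exists k.
  exact: filterI near_d near_g.
have := decN _ Nk; apply/negP; rewrite /= sub0r normrN -leNgt.
apply: le_trans (ler_norm _); rewrite zE.2; apply: le_trans (cw_descent _).
rewrite ler_pM2l //; apply: ler_pM => //; try exact: ltW.
by rewrite divr_ge0 // ltW.
Qed.

End sequence.

End armijo.

Theorem theorem0p1 (R : realType) (m1 m2 : nat) (f : 'rV[R]_(m1 + m2) -> R)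
    (alpha beta delta0 : R) (z0 : 'rV[R]_(m1 + m2))
    (z : nat -> 'rV[R]_(m1 + m2)) :
  C1 f ->
  0 < alpha < 1 -> 0 < beta < 1 -> 0 < delta0 ->
  cwBGD_sequence f alpha beta delta0 z0 z ->
  [/\ cluster_points z `<=` critical_set f,
      f \o z @ \oo --> -oo \/ enorm (z n.+1 - z n) @[n --> \oo] --> 0
    & forall B : set 'rV[R]_(m1 + m2),
        (exists2 p, critical_set f p &
           B = connected_component (critical_set f) p) ->
        compact B ->
        B `&` cluster_points z !=set0 ->
        cluster_points z `<=` B /\ connected (cluster_points z)].
Proof.
move=> C1f alpha01 beta01 delta0_gt0 zE.
have Ccrit := cluster_points_critical C1f alpha01 beta01 delta0_gt0 zE.
split => //.
  have [|[M Mf]] := cwBGD_unbounded_or_lbounded C1f alpha01 beta01 delta0_gt0 zE.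
    by left.
  right; exact: (cwBGD_step_cvg0 C1f alpha01 beta01 delta0_gt0 zE Mf).
move=> B [p _ ->] cB [q [Bq Cq]].
(* The cluster point [q] bounds [f] below along the sequence, which rules out divergence to minus
   infinity. *)
have step0 := cwBGD_step_cvg0 C1f alpha01 beta01 delta0_gt0 zE
  (cwBGD_lbounded C1f alpha01 beta01 delta0_gt0 zE Cq).
rewrite (same_connected_component Bq) in cB *.
apply: cluster_points_compact_component => //.
  apply: (squeeze_cvgr _ (cvg_cst 0) step0).
  by near=> n; rewrite normr_ge0 norm_le_enorm.
(* Closedness of the critical set, from continuity of the gradient. *)
rewrite (_ : critical_set f = gradient f @^-1` [set 0]) //.
apply: ((continuous_closedP _).1 C1f.2).
exact: (@compact_closed 'rV[R]_(m1 + m2) _ (@norm_hausdorff _ _)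
  (@compact_set1 _ _)).
Unshelve. all: by end_near. Qed.
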